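(* Let $X$ be an (AL)-space or an (AM)-space and let $T$ be a positive strongly Kreiss bounded operator on $X$. Then there exist $C,\kappa>0$ such that for every integer $N\ge1$, $$\|T^N\|\le C\log^\kappa(N+1).$$
   Context: A Banach lattice $X$ with positive cone $X_+$ is an (AL)-space if $\|x+y\|=\|x\|+\|y\|$ for all $x,y\in X_+$, and an (AM)-space if $\|\sup(x,y)\|=\sup(\|x\|,\|y\|)$ for all $x,y\in X_+$. An operator $T$ is positive if $T(X_+)\subset X_+$. A bounded linear operator $T$ on a complex Banach space $X$ (for Banach lattices, the usual complexification) is called strongly Kreiss bounded if $\sigma(T)\subset\overline{\mathbb D}$ (the closed unit disk) and there is $C>0$ such that $\|(\lambda-T)^{-k}\|\le \frac{C}{(|\lambda|-1)^k}$ for all $\lambda\in\mathbb C$ with $|\lambda|>1$ and all integers $k\ge1$; equivalently, there is $L>0$ with $\|e^{zT}\|\le Le^{|z|}$ for all $z\in\mathbb C$. Here $\log^\kappa(x)$ means $(\log x)^\kappa$. *)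

(* Defs.v *)
From HB Require Import structures.
From mathcomp Require Import all_boot all_order all_algebra.
From mathcomp Require Import all_classical all_reals all_analysis.
From mathcomp Require Import complex lra.

Set Implicit Arguments.
Unset Strict Implicit.
Unset Printing Implicit Defensive.

Import Order.TTheory GRing.Theory Num.Theory.
Import numFieldNormedType.Exports.

Local Open Scope classical_set_scope.
Local Open Scope ring_scope.

Reserved Notation "x <=: y" (at level 70, y at next level, no associativity).

(* The order lives in this mixin, not in a Lattice structure from the order
   library: an instance carrying both that structure and a normed module
   structure would need joins missing from the number hierarchy. *)
HB.mixin Record isBanachLattice (R : realType) (X : Type)
    & CompleteNormedModule R X := {
  ble : rel X ;
  bsup : X -> X -> X ;
  ble_refl : reflexive ble ;
  ble_anti : antisymmetric ble ;
  ble_trans : transitive ble ;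
  (* bsup x y is the least upper bound of x and y *)
  bsup_le : forall x y z : X, ble (bsup x y) z = ble x z && ble y z ;
  bleD2r : forall z x y : X, ble x y -> ble (x + z) (y + z) ;
  bscale_ge0 : forall (a : R) (x : X), 0 <= a -> ble 0 x -> ble 0 (a *: x) ;
  ble_norm : forall x y : X,
    ble (bsup x (- x)) (bsup y (- y)) -> `|x| <= `|y|
}.

#[short(type="banachLatticeType")]
HB.structure Definition BanachLattice (R : realType) :=
  {X of CompleteNormedModule R X & isBanachLattice R X}.

Arguments ble_trans {R s} [y x z].
Arguments ble_anti {R s} [x y].

Notation "x <=: y" := (ble x y) : ring_scope.

Definition babs (R : realType) (X : banachLatticeType R) (x : X) : X :=
  bsup x (- x).

Section RieszTheory.
Variables (R : realType) (X : banachLatticeType R).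
Implicit Types (x y z v : X) (a b e : R).

Lemma bleD x x' y y' : x <=: y -> x' <=: y' -> x + x' <=: y + y'.
Proof.
move=> xy xy'; apply: (@ble_trans _ _ (y + x')); first exact: bleD2r.
by rewrite ![y + _]addrC; exact: bleD2r.
Qed.

Lemma bsub_ge0 x y : (0 <=: y - x) = (x <=: y).
Proof.
apply/idP/idP => [/(bleD2r x)|/(bleD2r (- x))]; first by rewrite add0r subrK.
by rewrite subrr.
Qed.

Lemma bleN x y : x <=: y -> - y <=: - x.
Proof. by rewrite -bsub_ge0 -(bsub_ge0 (- y)) opprK addrC. Qed.

Lemma bleZ a x y : 0 <= a -> x <=: y -> a *: x <=: a *: y.
Proof.
move=> a0; rewrite -bsub_ge0 -(bsub_ge0 (a *: x)) -scalerBr.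
exact: bscale_ge0.
Qed.

Lemma bleZr a b x : a <= b -> 0 <=: x -> a *: x <=: b *: x.
Proof.
by move=> ab x0; rewrite -bsub_ge0 -scalerBl bscale_ge0// subr_ge0.
Qed.

Lemma bsup_ub x y : (x <=: bsup x y) && (y <=: bsup x y).
Proof. by rewrite -bsup_le ble_refl. Qed.

Lemma ble_abs x : x <=: babs x.
Proof. by have /andP[] := bsup_ub x (- x). Qed.

Lemma bleN_abs x : - x <=: babs x.
Proof. by have /andP[] := bsup_ub x (- x). Qed.

Lemma bhalf_ge0 x : 0 <=: x + x -> 0 <=: x.
Proof.
move=> /(@bscale_ge0 _ X 2^-1); rewrite invr_ge0 ler0n => /(_ isT).
have -> : x + x = (2 : R) *: x by rewrite scaler_nat mulr2n.
by rewrite scalerA mulVf ?scale1r// pnatr_eq0.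
Qed.

Lemma bge0_of x v : x <=: v -> - x <=: v -> 0 <=: v.
Proof.
by move=> xv nxv; apply: bhalf_ge0; rewrite -(subrr x); exact: bleD.
Qed.

Lemma babs_ge0 x : 0 <=: babs x.
Proof. exact: bge0_of (ble_abs x) (bleN_abs x). Qed.

Lemma babs_id x : 0 <=: x -> babs x = x.
Proof.
move=> x0; apply: ble_anti; rewrite ble_abs andbT bsup_le ble_refl/=.
by apply: (ble_trans _ x0); rewrite -oppr0 bleN.
Qed.

Lemma bnorm_le x v : x <=: v -> - x <=: v -> `|x| <= `|v|.
Proof.
by move=> xv nxv; apply: ble_norm; rewrite bsup_le !(ble_trans _ (ble_abs v)).
Qed.

Lemma bnorm_abs x : `|babs x| = `|x|.
Proof.
apply: le_anti; apply/andP; split; last first.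
  by apply: bnorm_le; [exact: ble_abs|exact: bleN_abs].
by apply: ble_norm; rewrite -/(babs (babs x)) babs_id ?babs_ge0 ?ble_refl.
Qed.

Lemma bscale_abs a b x : `|a| <= b -> a *: x <=: b *: babs x.
Proof.
move=> ab; apply: ble_trans (bleZr ab (babs_ge0 x)).
have [a0|/ltW a0] := ger0P a; first exact: bleZ (ble_abs x).
by rewrite -[a *: x]opprK -scaleNr -scalerN bleZ ?bleN_abs// oppr_ge0.
Qed.

Lemma ble0_lim x :
  (forall e, 0 < e -> exists2 v, `|v| <= e & x <=: v) -> x <=: 0.
Proof.
move=> h; suff p0 : bsup x 0 = 0 by have /andP[] := bsup_ub x 0; rewrite p0.
apply/eqP; rewrite -normr_le0; apply/ler_addgt0Pr => e e0; rewrite add0r.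
have [v ve xv] := h e e0; apply: le_trans ve; rewrite -[leRHS]bnorm_abs.
have p_le : bsup x 0 <=: babs v.
  by rewrite bsup_le babs_ge0 (ble_trans xv (ble_abs v)).
apply: bnorm_le => //; apply: (ble_trans _ (babs_ge0 v)).
by rewrite -[X in _ <=: X]oppr0 bleN//; have /andP[] := bsup_ub x 0.
Qed.

Definition bsups x (s : seq X) : X := foldr bsup x s.

Lemma bsups_le x s z :
  (bsups x s <=: z) = (x <=: z) && all (fun y => y <=: z) s.
Proof. by elim: s => [|y s IH] /=; rewrite ?andbT// bsup_le IH andbCA. Qed.

Lemma bsups_ub x s y : y \in s -> y <=: bsups x s.
Proof.
move=> ys; have := ble_refl (bsups x s); rewrite bsups_le => /andP[_ /allP].
exact.
Qed.

End RieszTheory.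

Section UnitCircle.
Variable R : realType.
Implicit Types c w : R[i].

Lemma cnorm_Re c : `|complex.Re c| <= complex.Re `|c|.
Proof. by have := normc_ge_Re c; rewrite lecE => /andP[]. Qed.

Lemma cnorm_Im c : `|complex.Im c| <= complex.Re `|c|.
Proof.
by rewrite normc_def/= -sqrtr_sqr ler_wsqrtr// lerDr sqr_ge0.
Qed.

Lemma cnormE c : `|c| = (complex.Re `|c|)%:C%C.
Proof. by rewrite normc_def. Qed.

Lemma circle_net n : exists s : seq R[i],
  (forall w, w \in s -> `|w| = 1) /\
  forall w, `|w| = 1 -> exists w', [/\ w' \in s,
    `|complex.Re (w - w')| <= n.+1%:R^-1 &
    `|complex.Im (w - w')| <= n.+1%:R^-1].
Proof.
pose k (a : R) := Num.truncn ((a + 1) * n.+1%:R).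
pose cell w := (k (complex.Re w), k (complex.Im w)).
pose rep p : R[i] := xget 1 [set w | `|w| = 1 /\ cell w = p].
exists [seq rep (i, j) | i <- iota 0 (n.+1 * 2).+1, j <- iota 0 (n.+1 * 2).+1].
have rep1 p : `|rep p| = 1.
  by rewrite /rep; case: xgetP => [w -> []|_]//; rewrite normr1.
have kP (a : R) : `|a| <= 1 ->
    k a \in iota 0 (n.+1 * 2).+1 /\ (k a)%:R <= (a + 1) * n.+1%:R < (k a).+1%:R.
  rewrite ler_norml => /andP[a1 a2].
  have a0 : 0 <= (a + 1) * n.+1%:R by rewrite mulr_ge0// -lerBlDr sub0r.
  have := truncn_itv a0; rewrite -/(k a) => itv; split => //.
  rewrite mem_iota add0n/= ltnS -(ler_nat R); have /andP[+ _] := itv.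
  by move/le_trans; apply; rewrite natrM mulrC ler_wpM2l//; lra.
have kclose (a b : R) : `|a| <= 1 -> `|b| <= 1 -> k a = k b ->
    `|a - b| <= n.+1%:R^-1.
  move=> /kP[_ /andP[a1 a2]] /kP[_ /andP[b1 b2]] kab.
  rewrite -[leRHS]mul1r ler_pdivlMr// -[X in _ * X]gtr0_norm// -normrM.
  rewrite ler_norml; move: a1 a2 b1 b2; rewrite kab -!natr1 => *; apply/andP.
  by split; nra.
have coord w : `|w| = 1 -> `|complex.Re w| <= 1 /\ `|complex.Im w| <= 1.
  move=> w1; have := cnorm_Re w; have := cnorm_Im w; rewrite w1/=.
  by split.
split=> [w /allpairsP[[i j] [_ _ ->]]//|w w1].
have [wr wi] := coord w w1.
exists (rep (cell w)); rewrite !raddfB.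
have /coord[rr ri] := rep1 (cell w).
have : cell (rep (cell w)) = cell w.
  by rewrite {1}/rep; case: xgetP => [w' -> []//|/(_ w)]; case.
move=> [kr ki]; split.
- apply: (allpairs_f (fun i j => rep (i, j))); first by case: (kP _ wr).
  by case: (kP _ wi).
- exact: kclose.
- exact: kclose.
Qed.

End UnitCircle.

(* The pair (x, y) stands for x + iy. *)
Definition complexification (X : Type) : Type := (X * X)%type.

HB.instance Definition _ (X : zmodType) :=
  GRing.Zmodule.copy (complexification X) (X * X)%type.

Section ComplexScale.
Variables (R : realType) (X : lmodType R).

Definition cscale (c : R[i]) (z : complexification X) : complexification X :=
  (complex.Re c *: z.1 - complex.Im c *: z.2,
   complex.Re c *: z.2 + complex.Im c *: z.1).

Lemma cscaleA b c z : cscale b (cscale c z) = cscale (b * c) z.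
Proof.
case: b c z => [b1 b2] [c1 c2] [x y]; rewrite /cscale/=.
rewrite !scalerBr !scalerDr !scalerBl !scalerDl !scalerA.
by congr (_, _); rewrite ?opprD !addrA addrAC; congr (_ + _); rewrite addrAC.
Qed.

Lemma cscale1 : left_id 1 cscale.
Proof. by case=> x y; rewrite /cscale/= !scale1r !scale0r subr0 addr0. Qed.

Lemma cscaleDr : right_distributive cscale +%R.
Proof.
move=> [a b] [x y] [x' y']; rewrite /cscale/= !scalerDr opprD.
by congr (_, _); rewrite addrACA.
Qed.

Lemma cscaleDl z : {morph cscale^~ z : b c / b + c}.
Proof.
move=> [a b] [a' b']; rewrite /cscale/= !scalerDl opprD.
by congr (_, _); rewrite addrACA.
Qed.

HB.instance Definition _ :=
  GRing.Zmodule_isLmodule.Build R[i] (complexification X)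
    cscaleA cscale1 cscaleDr cscaleDl.

Lemma cscaleE (c : R[i]) (z : complexification X) : c *: z =
  (complex.Re c *: z.1 - complex.Im c *: z.2,
   complex.Re c *: z.2 + complex.Im c *: z.1).
Proof. by []. Qed.

End ComplexScale.

Definition is_blub (R : realType) (X : banachLatticeType R)
    (A : set X) (m : X) : Prop :=
  (forall x, A x -> x <=: m) /\
  (forall b, (forall x, A x -> x <=: b) -> m <=: b).

Section Modulus.
Variables (R : realType) (X : banachLatticeType R).
Implicit Types (z : complexification X) (c w : R[i]) (m b : X).

(* The set of all Re (e^(it) z), t real. *)
Definition rotations z : set X :=
  [set (w *: z).1 | w in [set w : R[i] | `|w| = 1]].

(* |z| = sup_t Re (e^(it) z); this supremum exists in every Banach lattice, see
   modulusP, so the default value 0 is never used. *)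
Definition modulus z : X := xget 0 [set m | is_blub (rotations z) m].

Lemma is_blub_uniq (A : set X) m b : is_blub A m -> is_blub A b -> m = b.
Proof.
by move=> [Am lm] [Ab lb]; apply: ble_anti; rewrite lm// lb.
Qed.

Lemma rot_close z c (e : R) : `|complex.Re c| <= e -> `|complex.Im c| <= e ->
  (c *: z).1 <=: e *: (babs z.1 + babs z.2).
Proof.
move=> ce ie; rewrite cscaleE/= scalerDr -scaleNr.
by apply: bleD; apply: bscale_abs; rewrite ?normrN.
Qed.

Lemma rotationsN z x : rotations z x -> rotations z (- x).
Proof.
move=> [w w1 <-]; exists (- w); first by rewrite /= normrN.
by rewrite scaleNr.
Qed.

Lemma ub_ge0 z b : (forall x, rotations z x -> x <=: b) -> 0 <=: b.
Proof.
move=> zb; have h : rotations z (1 *: z).1 by exists 1; rewrite //= normr1.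
exact: bge0_of (zb _ h) (zb _ (rotationsN h)).
Qed.

Lemma ub_scale z b c : (forall x, rotations z x -> x <=: b) ->
  (c *: z).1 <=: complex.Re `|c| *: b.
Proof.
move=> zb; have [->|c0] := eqVneq c 0.
  by rewrite normr0 !scale0r; exact: ble_refl.
have -> : (c *: z).1 = complex.Re `|c| *: ((`|c|^-1 * c) *: z).1.
  have -> : c *: z = `|c| *: ((`|c|^-1 * c) *: z).
    by rewrite scalerA mulrA mulfV ?normr_eq0// mul1r.
  rewrite [in LHS]cnormE cscaleE/= scale0r subr0.
  by rewrite -cnormE.
apply: bleZ; first by rewrite -ler0c -cnormE.
apply: zb; exists (`|c|^-1 * c) => //=.
by rewrite normrM normfV normr_id mulVf// normr_eq0.
Qed.

Lemma modulus_exists z : exists m, is_blub (rotations z) m.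
Proof.
have [s sP] := choice (@circle_net R).
pose u := babs z.1 + babs z.2.
have u0 : 0 <=: u by rewrite -[0]addr0 bleD// babs_ge0.
pose F n := bsups z.1 [seq (w *: z).1 | w <- s n].
pose d n : R := n.+1%:R^-1.
have d0 n : 0 <= d n by rewrite invr_ge0.
have Fub n b : (forall x, rotations z x -> x <=: b) -> F n <=: b.
  move=> zb; rewrite bsups_le; apply/andP; split.
    by apply: zb; exists 1; [exact: normr1|rewrite scale1r].
  apply/allP => _ /mapP[w ws ->]; apply: zb; exists w => //.
  exact: (sP n).1.
have Frot n x : rotations z x -> x <=: F n + d n *: u.
  move=> [w w1 <-]; have [w' [w's re im]] := (sP n).2 w w1.
  rewrite -[w](subrK w') scalerDl addrC.
  apply: bleD; first by apply: bsups_ub; apply/mapP; exists w'.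
  exact: rot_close.
have Fle n p : F p - F n <=: d n *: u.
  by rewrite -bsub_ge0 opprB addrA bsub_ge0 addrC; apply: Fub; exact: Frot.
have Fclose n p : (n <= p)%N -> `|F n - F p| <= d n * `|u|.
  move=> np; rewrite -[d n]ger0_norm// -normrZ; apply: bnorm_le.
    apply: (ble_trans (Fle p n)); apply: bleZr => //.
    by rewrite lef_pV2 ?posrE// ler_nat.
  by rewrite opprB; exact: Fle.
have dlim (e : R) : 0 < e -> \forall n \near \oo, d n * `|u| <= e.
  move=> e0; exists (Num.truncn (`|u| / e)) => //= n ne.
  rewrite mulrC ler_pdivrMr// mulrC -ler_pdivrMr// ltW//.
  by rewrite (lt_le_trans (truncnS_gt _))// ler_nat.
have /cauchy_cvgP/cvg_ex[m /cvgrPdist_le Fm] : cauchy (F @ \oo).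
  apply: cauchy_exP => e e0.
  have /dlim[n _ /(_ n (leqnn n)) ne] : 0 < e / 2 by rewrite divr_gt0.
  exists (F n); exists n => // p /= /Fclose np.
  rewrite -ball_normE/=; apply: (le_lt_trans np); apply: (le_lt_trans ne).
  by rewrite ltr_pdivrMr// ltr_pMr// ltr1n.
have Fm0 (e : R) : 0 < e -> exists n, `|m - F n| <= e /\ d n * `|u| <= e.
  move=> e0; near \oo => n; exists n.
  by split; near: n; [exact: Fm|exact: dlim].
have sub_le0 x y : (x - y <=: 0) = (x <=: y).
  by rewrite -bsub_ge0 sub0r opprB bsub_ge0.
exists m; split=> [x zx|b zb]; rewrite -sub_le0; apply: ble0_lim => e e0.
  have /Fm0[n [mn dn]] : 0 < e / 2 by rewrite divr_gt0.
  exists (F n + d n *: u - m).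
    rewrite addrAC [leRHS]splitr (le_trans (ler_normD _ _))// lerD//.
      by rewrite distrC.
    by rewrite normrZ ger0_norm.
  by apply: bleD; [exact: Frot|exact: ble_refl].
have [n [mn _]] := Fm0 e e0; exists (m - F n) => //.
by apply: bleD; [exact: ble_refl|apply: bleN; exact: Fub].
Unshelve. all: by end_near. Qed.

Lemma modulusP z : is_blub (rotations z) (modulus z).
Proof.
rewrite /modulus; case: xgetP => [m _ //|no].
by have [m zm] := modulus_exists z; case: (no m).
Qed.

Lemma modulus_ge0 z : 0 <=: modulus z.
Proof. by have [zb _] := modulusP z; exact: ub_ge0 zb. Qed.

Lemma modulus_ub z c : (c *: z).1 <=: complex.Re `|c| *: modulus z.
Proof. by have [zb _] := modulusP z; exact: ub_scale zb. Qed.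

Lemma modulus_leD z z' : modulus (z + z') <=: modulus z + modulus z'.
Proof.
apply: (modulusP _).2 => _ [w w1 <-]; rewrite scalerDr.
by apply: bleD; apply: (modulusP _).1; exists w.
Qed.

Lemma modulus_leZ c z : modulus (c *: z) <=: complex.Re `|c| *: modulus z.
Proof.
apply: (modulusP _).2 => _ [w w1 <-]; rewrite scalerA.
by apply: (ble_trans (modulus_ub _ _)); rewrite normrM w1 mul1r ble_refl.
Qed.

Lemma Re_cnorm_ge0 c : 0 <= complex.Re `|c|.
Proof. by rewrite -ler0c -cnormE. Qed.

Lemma modulusZ c z : modulus (c *: z) = complex.Re `|c| *: modulus z.
Proof.
apply: ble_anti; rewrite modulus_leZ andTb.
have [->|c0] := eqVneq c 0; first by rewrite normr0 scale0r modulus_ge0.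
have := modulus_leZ c^-1 (c *: z); rewrite scalerA mulVf// scale1r.
move/(bleZ (Re_cnorm_ge0 c)); rewrite scalerA.
suff -> : complex.Re `|c| * complex.Re `|c^-1| = 1 by rewrite scale1r.
apply: complexI; rewrite rmorphM/= -!cnormE -normrM mulfV//.
by rewrite normr1.
Qed.

Lemma norm1_le_modulus z : `|z.1| <= `|modulus z|.
Proof.
have [zb _] := modulusP z.
have h : rotations z (1 *: z).1 by exists 1; rewrite //= normr1.
rewrite scale1r in h.
by apply: bnorm_le; apply: zb => //; exact: rotationsN.
Qed.

Lemma norm2_le_modulus z : `|z.2| <= `|modulus z|.
Proof.
have [zb _] := modulusP z.
have h : rotations z (- 'i%C *: z).1.
  exists (- 'i%C) => //=.
  by rewrite normrN normc_def/= expr0n expr1n add0r sqrtr1.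
have E : (- 'i%C *: z).1 = z.2.
  by rewrite cscaleE/= oppr0 scale0r scaleN1r opprK add0r.
rewrite E in h.
by apply: bnorm_le; apply: zb => //; exact: rotationsN.
Qed.

Lemma norm_modulus_le z : `|modulus z| <= `|z.1| + `|z.2|.
Proof.
rewrite -(bnorm_abs z.1) -(bnorm_abs z.2).
apply: le_trans (ler_normD _ _); apply: bnorm_le; last first.
  apply: (@ble_trans _ _ 0); first by rewrite -oppr0 bleN// modulus_ge0.
  by rewrite -[0]addr0 bleD// babs_ge0.
apply: (modulusP _).2 => _ [w w1 <-]; rewrite -[X in _ <=: X]scale1r.
apply: rot_close; first by rewrite (le_trans (cnorm_Re _))// w1.
by rewrite (le_trans (cnorm_Im _))// w1.
Qed.

Definition cnorm z : R[i] := (`|modulus z|)%:C%C.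

Lemma cnormD z z' : cnorm (z + z') <= cnorm z + cnorm z'.
Proof.
rewrite /cnorm -rmorphD/= lecR; apply: le_trans (ler_normD _ _).
apply: bnorm_le; first exact: modulus_leD.
apply: (@ble_trans _ _ 0); first by rewrite -oppr0 bleN// modulus_ge0.
by rewrite -[0]addr0 bleD// modulus_ge0.
Qed.

Lemma cnormZ c z : cnorm (c *: z) = `|c| * cnorm z.
Proof.
by rewrite /cnorm modulusZ normrZ ger0_norm ?Re_cnorm_ge0// rmorphM/= -cnormE.
Qed.

Lemma cnorm0_eq0 z : cnorm z = 0 -> z = 0.
Proof.
move=> /complexI z0; have := norm1_le_modulus z; have := norm2_le_modulus z.
by rewrite z0 !normr_le0; case: z {z0} => x y /= /eqP-> /eqP->.
Qed.

HB.instance Definition _ := @Lmodule_isNormed.Build R[i] (complexification X)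
  cnorm cnormD cnormZ cnorm0_eq0.

Lemma complexification_normE z : `|z| = (`|modulus z|)%:C%C.
Proof. by []. Qed.

Lemma complexification_complete (F : set_system (complexification X)) :
  ProperFilter F -> cauchy F -> cvg F.
Proof.
move=> FF /cauchyP cF.
have comp (p : complexification X -> X) :
    (forall z z', p (z - z') = p z - p z') ->
    (forall z, `|p z| <= `|modulus z|) -> cvg (p @ F).
  move=> pB ple; apply/cauchy_cvgP; apply: cauchy_exP => e e0.
  have /cF[z zF] : 0 < e%:C%C :> R[i] by rewrite ltcE/= eqxx.
  exists (p z); have sub : ball z e%:C%C `<=` p @^-1` ball (p z) e.
    move=> z'; rewrite /preimage/= -!ball_normE => zz'.
    have : `|z - z'| < e%:C%C by exact: zz'.
    rewrite complexification_normE ltcR => h; rewrite /ball_/= -pB.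
    exact: le_lt_trans h.
  exact: filterS sub zF.
have /cvg_ex[x /cvgrPdist_lt Fx] :=
  comp fst (fun _ _ => erefl) norm1_le_modulus.
have /cvg_ex[y /cvgrPdist_lt Fy] :=
  comp snd (fun _ _ => erefl) norm2_le_modulus.
apply/cvg_ex; exists ((x, y) : complexification X).
apply/cvgrPdist_lt => -[r i].
rewrite ltcE/= => /andP[/eqP-> r0].
have r20 : 0 < r / 2 by rewrite divr_gt0.
near=> z; rewrite complexification_normE ltcR.
rewrite (le_lt_trans (norm_modulus_le _))//=.
rewrite [ltRHS]splitr ltrD//; near: z; [exact: Fx|exact: Fy].
Unshelve. all: by end_near. Qed.

HB.instance Definition _ :=
  Uniform_isComplete.Build (complexification X) complexification_complete.

End Modulus.

Section Operators.
Variables (R : realType) (V : completeNormedModType R[i]).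
Implicit Types (T S : {linear V -> V}) (lambda : R[i]) (k : nat).

(* The library norm on V takes values in R[i]; this is the same norm in R. *)
Definition rnorm (W : normedZmodType R[i]) (x : W) : R := complex.Re `|x|.

Definition bounded_op (f : V -> V) : Prop :=
  exists M : R, forall x, rnorm (f x) <= M * rnorm x.

Definition opnorm (f : V -> V) : R :=
  sup [set rnorm (f x) | x in [set x | rnorm x <= 1]].

(* S = (lambda - T)^-1 as a bounded operator; such an S is unique. *)
Definition is_resolvent T lambda S : Prop :=
  [/\ bounded_op S,
      cancel (fun x => lambda *: x - T x) S &
      cancel S (fun x => lambda *: x - T x)].

Definition spectrum T : set R[i] :=
  [set lambda | ~ exists S, is_resolvent T lambda S].

Definition strongly_Kreiss_bounded T : Prop :=
  [/\ bounded_op T,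
      spectrum T `<=` [set lambda | rnorm lambda <= 1] &
      exists2 C : R, 0 < C &
        forall lambda S k, 1 < rnorm lambda -> is_resolvent T lambda S ->
          (1 <= k)%N -> opnorm (iter k S) <= C / (rnorm lambda - 1) ^+ k].

End Operators.

Section BanachLatticeNotions.
Variables (R : realType) (X : banachLatticeType R).

Definition AL_space : Prop :=
  forall x y : X, 0 <=: x -> 0 <=: y -> `|x + y| = `|x| + `|y|.

Definition AM_space : Prop :=
  forall x y : X, 0 <=: x -> 0 <=: y -> `|bsup x y| = Num.max `|x| `|y|.

(* X_+ inside the complexification: x + i0 with x >= 0. *)
Definition pos_cone : set (complexification X) :=
  [set z | 0 <=: z.1 /\ z.2 = 0].

Definition positive_op (T : complexification X -> complexification X) : Prop :=
  T @` pos_cone `<=` pos_cone.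

End BanachLatticeNotions.

Arguments AL_space {R} X.
Arguments AM_space {R} X.

(* Main.v *)
From HB Require Import structures.
Require Import Defs.
From mathcomp Require Import all_boot all_order all_algebra.
From mathcomp Require Import all_classical all_reals all_analysis.
From mathcomp Require Import complex zify ring lra.

(* The resolvent S = (2 - T)^-1 is positive: it is a Neumann series in the
   resolvent at a large real point, which is itself a Neumann series in T.
   Expanding S^N in powers of T gives negative binomial weights centred at N
   with standard deviation of order sqrt N, so the window [N - D, N] with D
   of order sqrt N carries a fixed proportion of the mass, while S^N is
   bounded in N by the Kreiss condition. Each T^N x equals T^j (T^(N-j) x)
   for j <= D: in an (AL)-space average the norms of T^(N-j) x over the
   window, in an (AM)-space apply S^N to the supremum of the T^j x, j <= D.
   Either way |T^N| <= K max_(j <= D) |T^j|, and since D <= sqrt N,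
   iterating this of the order of log log N times yields a power of log N. *)

Set Implicit Arguments.
Unset Strict Implicit.
Unset Printing Implicit Defensive.

Import Order.TTheory GRing.Theory Num.Theory.
Import numFieldNormedType.Exports.

Local Open Scope classical_set_scope.
Local Open Scope ring_scope.

(** * Negative binomial weights: recurrences and mass near the centre *)

Section NegativeBinomial.
Variable R : realType.

(* The coefficient of T^n in (2 - T)^-N. *)
Definition nbin (N n : nat) : R := 'C((n + N).-1, n)%:R / 2 ^+ (n + N).

Lemma nbin_ge0 N n : 0 <= nbin N n.
Proof. by rewrite mulr_ge0// invr_ge0 exprn_ge0. Qed.

(** The truncated predecessor in [nbin] makes row 0 the coefficients of the identity. *)
Lemma nbin0S n : nbin 0 n.+1 = 0.
Proof. by rewrite /nbin addn0/= bin_small ?mul0r. Qed.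

Lemma nbinS0 N : 2 * nbin N.+1 0 = nbin N 0.
Proof. by rewrite /nbin !add0n !bin0 exprS; field; rewrite expf_neq0. Qed.

(** Pascal's rule, the coefficientwise form of 2 S^(N+1) = S^N + T S^(N+1). *)
Lemma nbinSS N n : 2 * nbin N.+1 n.+1 = nbin N n.+1 + nbin N.+1 n.
Proof.
rewrite /nbin !addnS !addSn/= binS natrD (exprS _ (n + N).+1).
by field; rewrite expf_neq0.
Qed.

Lemma nbin_pred N n : (0 < N)%N ->
  nbin N n * (n + N)%:R = nbin N n.+1 * (2 * n.+1%:R).
Proof.
case: N => // N _; rewrite /nbin addSn addnS/=.
have : (n.+1 * 'C((n + N).+1, n.+1) = (n + N).+1 * 'C(n + N, n))%N.
  by rewrite -mul_bin_diag.
move/(congr1 (fun k => k%:R : R)); rewrite !natrM => H.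
rewrite (exprS _ (n + N).+1).
apply: (@mulIf _ (2 * 2 ^+ (n + N).+1)); first by rewrite mulf_neq0// expf_neq0.
transitivity ((n + N).+1%:R * 'C(n + N, n)%:R * 2 : R).
  by field; rewrite expf_neq0.
by rewrite -H; field; rewrite expf_neq0.
Qed.

Lemma nbin_succ_trials N n : (0 < N)%N ->
  nbin N.+1 n * (2 * N%:R) = nbin N n * (n + N)%:R.
Proof.
case: N => // N _; rewrite /nbin !addnS/=.
have : ((n + N).+1 * 'C(n + N, n) = N.+1 * 'C((n + N).+1, n))%N.
  have := mul_bin_down (n + N).+1 n.
  by rewrite (_ : ((n + N).+1 - n = N.+1)%N)//; lia.
move/(congr1 (fun k => k%:R : R)); rewrite !natrM => H.
rewrite (exprS _ (n + N).+1).
transitivity (N.+1%:R * 'C((n + N).+1, n)%:R / 2 ^+ (n + N).+1 : R).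
  by field; rewrite expf_neq0.
by rewrite -H; field; rewrite expf_neq0.
Qed.

(** N times the squared central weight is nondecreasing in N, and N = 1 gives equality. Squaring
    avoids the root in the bound 1 / (4 sqrt N). *)
Lemma nbin_mode N : (0 < N)%N -> 1 <= 16 * N%:R * nbin N N ^+ 2.
Proof.
case: N => // N _; elim: N => [|N IH]; first by rewrite /nbin/= bin1; lra.
have n0 : 0 < N.+1%:R :> R by [].
have := nbin_pred N.+1 (ltn0Sn N.+1); have := nbin_succ_trials N.+1 (ltn0Sn N).
rewrite !natrD -![N.+2%:R]natr1; move: IH n0.
set n := N.+1%:R; set c := nbin N.+1 N.+1.
set d := nbin N.+2 N.+1; set e := nbin N.+2 N.+2 => IH n0 Ed.
have -> : d = c by apply: (@mulIf _ (2 * n)); lra.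
move=> Ee; have E : e = c * ((2 * n + 1) / (2 * (n + 1))).
  by apply: (@mulIf _ (2 * (n + 1))); [lra|rewrite -Ee; field; lra].
apply: (le_trans IH).
rewrite -subr_ge0 E.
have -> : 16 * (n + 1) * (c * ((2 * n + 1) / (2 * (n + 1)))) ^+ 2
    - 16 * n * c ^+ 2 = 4 * c ^+ 2 / (n + 1) by field; lra.
by rewrite divr_ge0 ?mulr_ge0 ?sqr_ge0//; lra.
Qed.

(** Going from N - j down to N - j - 1 multiplies the weight by 2 (N - j) / (2 N - j - 1) >= 1 - j /
    N; a Bernoulli-type induction bounds the product of these factors. *)
Lemma nbin_near_mode N j : (0 < N)%N -> (j ^ 2 <= N)%N ->
  nbin N N * (1 - j%:R ^+ 2 / N%:R) <= nbin N (N - j).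
Proof.
move=> N0; have n0 : 0 < N%:R :> R by rewrite ltr0n.
elim: j => [_|j IH jN]; first by rewrite expr0n mul0r subr0 mulr1 subn0.
have /IH {IH}: (j ^ 2 <= N)%N by nia.
have jltN : (j < N)%N by nia.
have -> : (N - j = (N - j.+1).+1)%N by lia.
have := nbin_pred (N - j.+1) N0; have := nbin_ge0 N (N - j.+1).+1.
have := nbin_ge0 N (N - j.+1); have := nbin_ge0 N N.
have -> : ((N - j.+1).+1 = N - j)%N by lia.
rewrite natrD (natrB _ jltN) (natrB _ (ltnW jltN)) -natr1.
set a := nbin _ _; set b := nbin _ _; set d := nbin _ _.
set n : R := N%:R in n0 *; set x : R := j%:R => a0 b0 d0 E IH.
have x0 : 0 <= x by rewrite ler0n.
have xn : x + 1 <= n by rewrite natr1 ler_nat.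
have h : d * (1 - x / n) <= b.
  have -> : 1 - x / n = 2 * (n - x) / (2 * n) by field; lra.
  rewrite mulrA -E ler_pdivrMr; last by lra.
  by apply: ler_wpM2l => //; lra.
apply: le_trans h; apply: (@le_trans _ _ (a * (1 - x ^+ 2 / n) * (1 - x / n))).
  rewrite -mulrA; apply: ler_wpM2l => //.
  have -> : 1 - (x + 1) ^+ 2 / n = (1 - x ^+ 2 / n) * (1 - x / n) - 
     ((x + 1) / n + x ^+ 3 / n ^+ 2) by field; lra.
  rewrite lerBlDr lerDl addr_ge0// divr_ge0 ?exprn_ge0//; lra.
by apply: ler_wpM2r => //; rewrite subr_ge0 ler_pdivrMr// mul1r; lra.
Qed.

(** Each weight in the window is at least half the central one, as j^2 <= N / 2, and D + 1 > sqrt (N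
    / 2). The mass is thus at least 1 / (8 sqrt 2) > 1 / 12. *)
Lemma nbin_window N D : (0 < N)%N -> (2 * D ^ 2 <= N)%N ->
  (N < 2 * D.+1 ^ 2)%N -> 12^-1 <= \sum_(j < D.+1) nbin N (N - j).
Proof.
move=> N0 DN ND; have n0 : 0 < N%:R :> R by rewrite ltr0n.
apply: (@le_trans _ _ (\sum_(j < D.+1) nbin N N / 2)).
  rewrite sumr_const card_ord -[leRHS]mulr_natr.
  have v0 := nbin_ge0 N N; have := nbin_mode N0; set v := nbin _ _ in v0 *.
  have : N%:R <= 2 * D.+1%:R ^+ 2 :> R by rewrite -natrX -natrM ler_nat ltnW.
  set d : R := D.+1%:R; have d0 : 0 <= d by rewrite ler0n.
  move=> Nd h; rewrite leNgt; apply/negP => lt.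
  have : (v / 2 * d) ^+ 2 < 12^-1 ^+ 2.
    by rewrite ltr_pXn2r// nnegrE ?mulr_ge0//; lra.
  have : 16 * N%:R * v ^+ 2 <= 16 * (2 * d ^+ 2) * v ^+ 2.
    by apply: ler_wpM2r; [exact: sqr_ge0|lra].
  by move=> *; lra.
apply: ler_sum => -[j /= jD] _; apply: le_trans (nbin_near_mode _ _) => //.
  apply: ler_wpM2l; first exact: nbin_ge0.
  rewrite -[leLHS]mul1r lerBrDr addrC -lerBrDr ler_pdivrMr//.
  have : (2 * j ^ 2 <= N)%N by nia.
  by rewrite -(ler_nat R) natrM natrX; lra.
by nia.
Qed.

End NegativeBinomial.

(** * Cone and operator norm in the complexification; positive resolvents *)

Section ComplexNorm.
Variables (R : realType) (X : banachLatticeType R).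
Implicit Types (z : complexification X) (x : X).

Lemma rnormE z : rnorm z = `|modulus z|.
Proof. by []. Qed.

Lemma rnorm_realC (a : R) : rnorm (a%:C%C : R[i]) = `|a|.
Proof. by rewrite /rnorm normc_def/= expr0n addr0 sqrtr_sqr. Qed.

Lemma rnormZr (a : R) z : rnorm (a%:C%C *: z) = `|a| * rnorm z.
Proof.
rewrite !rnormE modulusZ normrZ -[complex.Re _]/(rnorm _) rnorm_realC.
by rewrite normr_id.
Qed.

Lemma rnorm_real x : rnorm ((x, 0) : complexification X) = `|x|.
Proof.
apply: le_anti; rewrite rnormE.
have /= h := norm_modulus_le ((x, 0) : complexification X).
rewrite normr0 addr0 in h; rewrite h/=.
exact: (norm1_le_modulus ((x, 0) : complexification X)).
Qed.

Lemma scale_realC (a : R) z : a%:C%C *: z = (a *: z.1, a *: z.2).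
Proof. by rewrite cscaleE/= !scale0r subr0 addr0. Qed.

Lemma pos_coneD z z' : pos_cone z -> pos_cone z' -> pos_cone (z + z').
Proof.
case: z z' => [x y] [x' y'] [/= x0 ->] [/= x0' ->]; split => /=;
  last exact: addr0.
by rewrite -[0]addr0 bleD.
Qed.

Lemma pos_coneZ (a : R) z : 0 <= a -> pos_cone z -> pos_cone (a%:C%C *: z).
Proof.
move=> a0 [z1 z2]; rewrite scale_realC; split => /=; first exact: bscale_ge0.
by rewrite z2 scaler0.
Qed.

Lemma positive_opP (A : complexification X -> complexification X) :
  positive_op A -> forall z, pos_cone z -> pos_cone (A z).
Proof. by move=> hA z z0; apply: hA; exists z. Qed.

Lemma pos_cone_iter (A : complexification X -> complexification X) K z :
  positive_op A -> pos_cone z -> pos_cone (iter K A z).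
Proof. by move=> hA z0; elim: K => //= K; exact: positive_opP. Qed.

(** Norm closedness of the cone, used to discard a vanishing Neumann remainder. *)
Lemma pos_cone_closed z :
  (forall e, 0 < e -> exists2 r, rnorm r <= e & pos_cone (z - r)) -> pos_cone z.
Proof.
move=> h; split.
  rewrite -bsub_ge0 subr0 -[z.1]opprK -sub0r bsub_ge0.
  apply: ble0_lim => e /h[r re [/= zr _]]; exists (- r.1).
    by rewrite normrN (le_trans (norm1_le_modulus r)).
  by apply: bleN; rewrite -bsub_ge0.
apply/eqP; rewrite -normr_le0; apply/ler_addgt0Pr => e /h[r re [_ /=]].
move=> /eqP; rewrite add0r subr_eq0 => /eqP ->.
by rewrite (le_trans (norm2_le_modulus r)).
Qed.

(* y = \sum_(n < K) c^n A^n x + c^K A^K y, with positive sums and a remainder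
   tending to 0. *)
Lemma neumann_pos (A : {linear complexification X -> complexification X})
    (c D q : R) (x y : complexification X) :
  positive_op A -> 0 <= c -> 0 <= q < 1 ->
  (forall K, rnorm (c%:C%C ^+ K *: iter K A y) <= D * q ^+ K) ->
  y = x + c%:C%C *: A y -> pos_cone x -> pos_cone y.
Proof.
move=> hA c0 /andP[q0 q1] hD yE x0.
have hK K : pos_cone (y - c%:C%C ^+ K *: iter K A y).
  elim: K => [|K IH].
    by rewrite expr0 scale1r subrr; split; rewrite //= ble_refl.
  have -> : y - c%:C%C ^+ K.+1 *: iter K.+1 A y =
     (y - c%:C%C ^+ K *: iter K A y) + c%:C%C ^+ K *: iter K A x.
    have -> : c%:C%C ^+ K.+1 *: iter K.+1 A y = c%:C%C ^+ K *: iter K A (y - x).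
      have -> : y - x = c%:C%C *: A y by rewrite {1}yE addrC addKr.
      have itZ : iter K A (c%:C%C *: A y) = c%:C%C *: iter K A (A y).
        by elim: K {IH} => //= K ->; rewrite linearZ.
      by rewrite itZ -iterSr scalerA exprSr.
    have itB u v : iter K A (u - v) = iter K A u - iter K A v.
      by elim: K {IH} => //= K ->; rewrite linearB.
    by rewrite itB scalerBr opprB addrCA addrC -addrA [- _ + _]addrC addrA.
  apply: pos_coneD => //; rewrite -rmorphXn.
  by apply: pos_coneZ; [exact: exprn_ge0|exact: pos_cone_iter].
apply: pos_cone_closed => e e0.
have : (fun K => D * q ^+ K) @ \oo --> D * 0.
  by apply: cvgMl_tmp; apply: cvg_expr; rewrite ger0_norm.
rewrite mulr0 => /cvgrPdist_le /(_ e e0)[K _ /(_ K (leqnn K))].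
rewrite sub0r normrN => /ler_normlW h.
by exists (c%:C%C ^+ K *: iter K A y) => //; exact: le_trans (hD K) h.
Qed.

(** A real x is the difference of the positive vectors |x| and |x| - x, so a positive operator
    preserves the real part; the growth estimate can then be made in X. *)
Lemma positive_op_real (A : {linear complexification X -> complexification X}) :
  positive_op A -> exists2 a : {linear X -> X},
    (forall x, A (x, 0) = (a x, 0)) & (forall x, 0 <=: x -> 0 <=: a x).
Proof.
move=> hA.
pose i x : complexification X := (x, 0).
have iD x y : i (x + y) = i x + i y by congr (_, _); rewrite /= addr0.
have iB x y : i (x - y) = i x - i y by congr (_, _); rewrite /= subr0.
have iZ (k : R) x : i (k *: x) = k%:C%C *: i x by rewrite scale_realC/= scaler0.
have hA2 x : (A (i x)).2 = 0.
  have := ble_abs x; rewrite -bsub_ge0 => dx.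
  have -> : x = babs x - (babs x - x) by rewrite subKr.
  rewrite iB linearB/=.
  have [_ ->] := positive_opP hA
    (conj (babs_ge0 x) erefl : pos_cone (i (babs x))).
  have [_ ->] := positive_opP hA (conj dx erefl : pos_cone (i (babs x - x))).
  exact: subr0.
pose f x := (A (i x)).1.
have flin : linear f.
  by move=> k x y; rewrite /f iD iZ linearD linearZZ scale_realC.
pose lf := GRing.isLinear.Build R X X *:%R f flin.
pose F : {linear X -> X} := HB.pack f lf.
exists F => x; first by rewrite [LHS]surjective_pairing; rewrite -/(i x) hA2.
by move=> x0; have [] := positive_opP hA (conj x0 erefl : pos_cone (i x)).
Qed.

(** Boundedness of [f] bounds the set under the [sup] by |M|^k, so that [opnorm] really is an upper
    bound. *)
Lemma rnorm_le_opnorm (f : {linear complexification X -> complexification X})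
    k z : bounded_op f -> rnorm (iter k f z) <= opnorm (iter k f) * rnorm z.
Proof.
move=> [M hM].
have itZ (a : R) u : iter k f (a%:C%C *: u) = a%:C%C *: iter k f u.
  by elim: k => //= k ->; rewrite linearZ.
have it0 u : rnorm (iter k f u) <= `|M| ^+ k * rnorm u.
  elim: k {itZ} => [|k IH] /=; first by rewrite expr0 mul1r.
  rewrite (le_trans (hM _))// exprS -mulrA.
  apply: (@le_trans _ _ (`|M| * rnorm (iter k f u))).
    by apply: ler_wpM2r; [rewrite rnormE|exact: ler_norm].
  exact: ler_wpM2l.
have [z0|z0] := eqVneq (rnorm z) 0.
  by have := it0 z; rewrite z0 !mulr0.
have zp : 0 < rnorm z by rewrite lt_neqAle eq_sym z0 rnormE/=.
rewrite -ler_pdivrMr//.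
have -> : rnorm (iter k f z) / rnorm z =
    rnorm (iter k f ((rnorm z)^-1%:C%C *: z)).
  by rewrite itZ rnormZr ger0_norm ?invr_ge0 ?(ltW zp)// mulrC.
apply: ub_le_sup.
  exists (`|M| ^+ k) => _ [u u1 <-]; apply: (le_trans (it0 u)).
  by rewrite ler_piMr// exprn_ge0.
exists ((rnorm z)^-1%:C%C *: z) => //=.
by rewrite rnormZr ger0_norm ?invr_ge0 ?(ltW zp)// mulVf.
Qed.

Lemma resolvent_exists
    (T : {linear complexification X -> complexification X}) (a : R) :
  strongly_Kreiss_bounded T -> 1 < a ->
  exists S : {linear complexification X -> complexification X},
   is_resolvent T a%:C%C S.
Proof.
move=> [_ hT _] a1; apply: contrapT => no; have /= := hT _ no.
by rewrite rnorm_realC ger0_norm ?leNgt ?a1//; lra.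
Qed.

Lemma resolvent_pos (T : {linear complexification X -> complexification X})
    (S : {linear complexification X -> complexification X}) (b : R) :
  positive_op T -> strongly_Kreiss_bounded T -> 1 < b ->
  is_resolvent T b%:C%C S -> positive_op S.
Proof.
move=> hpos hT b1 hS.
have [[M hM] _ [C C0 hC]] := hT.
(* Large enough that |M| / a < 1, for the series in T, and that a - b >= 0, for the series in Q. *)
pose a := `|M| + b + 1.
have M0 : 0 <= `|M| by [].
have a1 : 1 < a by rewrite /a; lra.
have [Q hQ] := resolvent_exists hT a1.
have posQ : positive_op Q.
  move=> _ [x x0 <-]; case: (hQ) => _ _ /(_ x) /= E.
  (* The fixed-point equation is (a - T) Q x = x divided by a. *)
  apply: (@neumann_pos T a^-1 (rnorm (Q x)) (`|M| / a) (a^-1%:C%C *: x)) => //.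
  - by rewrite invr_ge0; lra.
  - by rewrite divr_ge0//= ?ltr_pdivrMr; rewrite /a; lra.
  - move=> K; rewrite -rmorphXn rnormZr ger0_norm; last first.
      by rewrite exprn_ge0// invr_ge0; lra.
    rewrite exprMn mulrA mulrC; apply: ler_wpM2r; first
      by rewrite exprn_ge0// invr_ge0; lra.
    elim: K => [|K IH]; first by rewrite mulr1.
    apply: (le_trans (hM _)); rewrite exprS mulrCA.
    apply: (@le_trans _ _ (`|M| * rnorm (iter K T (Q x)))).
      by apply: ler_wpM2r; [rewrite rnormE|exact: ler_norm].
    exact: ler_wpM2l.
  - rewrite -scalerDr -{2}E subrK scalerA -rmorphM/= mulVf ?scale1r//; lra.
  - by apply: pos_coneZ => //; rewrite invr_ge0; lra.
move=> _ [x x0 <-]; case: (hS) => _ _ /(_ x) /= E.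
have [bQ QK _] := hQ.
(* S = Q + (a - b) Q S, and the Kreiss bound on all powers of Q makes this
   series converge for every b > 1 in a single step. *)
apply: (@neumann_pos Q (a - b) (C * rnorm (S x) + rnorm (S x))
  ((a - b) / (a - 1)) (Q x)) => //.
- by rewrite /a; lra.
- by rewrite divr_ge0//= ?ltr_pdivrMr; rewrite /a; lra.
(* The Kreiss bound starts at the first power; the extra summand [rnorm (S x)] covers K = 0. *)
- move=> K; case: K => [|K].
    rewrite !expr0 scale1r mulr1 lerDr mulr_ge0 ?(ltW C0)// rnormE;
      exact: normr_ge0.
  apply: (@le_trans _ _ (C * rnorm (S x) * ((a - b) / (a - 1)) ^+ K.+1));
      last first.
    apply: ler_wpM2r; last by rewrite lerDl rnormE.
    by rewrite exprn_ge0// divr_ge0// /a; lra.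
  rewrite -rmorphXn rnormZr ger0_norm; last by rewrite exprn_ge0// /a; lra.
  rewrite exprMn mulrCA; apply: ler_wpM2l; first by rewrite exprn_ge0// /a; lra.
  apply: (le_trans (rnorm_le_opnorm _ _ bQ)).
  rewrite mulrAC exprVn; apply: ler_wpM2r; first by rewrite rnormE.
  have := hC _ _ K.+1 _ hQ isT; rewrite rnorm_realC ger0_norm; last by lra.
  exact.
(* Resolvent identity: x = (b - T) S x gives x + (a - b) S x = (a - T) S x, which Q sends to S x. *)
- have <- : Q (x + (a - b)%:C%C *: S x) = Q x + (a - b)%:C%C *: Q (S x).
    by rewrite linearD linearZZ.
  have -> : x + (a - b)%:C%C *: S x = a%:C%C *: S x - T (S x).
    by rewrite -{1}E addrAC -scalerDl -rmorphD/= subrKC.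
  by rewrite QK.
- by apply: posQ; exists x.
Qed.

End ComplexNorm.

(** * Order and norm of finite sums and suprema of positive vectors *)

Section PositiveSums.
Variables (R : realType) (X : banachLatticeType R).

Lemma ble_sum (I : Type) (r : seq I) (P : pred I) (F G : I -> X) :
  (forall i, P i -> F i <=: G i) ->
  \sum_(i <- r | P i) F i <=: \sum_(i <- r | P i) G i.
Proof.
move=> h; apply: (big_ind2 (fun x y => x <=: y)) => //; first exact: ble_refl.
by move=> *; exact: bleD.
Qed.

Lemma bsum_ge0 (I : Type) (r : seq I) (P : pred I) (F : I -> X) :
  (forall i, P i -> 0 <=: F i) -> 0 <=: \sum_(i <- r | P i) F i.
Proof.
by move=> /(@ble_sum I r P (fun=> 0) F); rewrite big1.
Qed.

Lemma norm_ble (x y : X) : 0 <=: x -> x <=: y -> `|x| <= `|y|.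
Proof.
move=> x0 xy; apply: bnorm_le => //.
by apply: ble_trans (ble_trans x0 xy); rewrite -oppr0; exact: bleN.
Qed.

Lemma AL_norm_sum (I : Type) (r : seq I) (F : I -> X) : AL_space X ->
  (forall i, 0 <=: F i) -> `|\sum_(i <- r) F i| = \sum_(i <- r) `|F i|.
Proof.
move=> hX F0; elim: r => [|i r IH]; first by rewrite !big_nil normr0.
by rewrite !big_cons hX ?IH//; exact: bsum_ge0.
Qed.

Lemma AM_norm_bsups (x : X) (s : seq X) (b : R) : AM_space X ->
  (forall y, y \in x :: s -> 0 <=: y /\ `|y| <= b) -> `|bsups x s| <= b.
Proof.
move=> hX h.
(* The (AM) identity holds on the cone only, so the induction also carries positivity. *)
suff: 0 <=: bsups x s /\ `|bsups x s| <= b by case.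
elim: s h => [|y s IH] h; first by apply: h; rewrite mem_head.
have [y0 yb] : 0 <=: y /\ `|y| <= b by apply: h; rewrite !inE eqxx orbT.
have [|s0 sb] := IH.
  by move=> z zs; apply: h; rewrite !inE in zs *;
    case/orP: zs => ->; rewrite ?orbT.
split=> /=; last by rewrite hX// ge_max yb.
by apply: (ble_trans y0); have /andP[] := bsup_ub y (bsups x s).
Qed.

Lemma positive_mono (f : {linear X -> X}) : (forall x, 0 <=: x -> 0 <=: f x) ->
  {homo f : x y / x <=: y}.
Proof.
by move=> f0 x y; rewrite -bsub_ge0 => /f0; rewrite linearB bsub_ge0.
Qed.

Lemma positive_iter (f : {linear X -> X}) n x :
  (forall x, 0 <=: x -> 0 <=: f x) -> 0 <=: x -> 0 <=: iter n f x.
Proof. by move=> f0 x0; elim: n => //= n; exact: f0. Qed.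

Lemma positive_iter_mono (f : {linear X -> X}) n :
  (forall x, 0 <=: x -> 0 <=: f x) -> {homo iter n f : x y / x <=: y}.
Proof. by move=> f0 x y xy; elim: n => //= n; exact: positive_mono. Qed.

End PositiveSums.

(** For D >= 2, (D + 2)^5 <= (2 D)^5 <= (2 D^2)^4; the remaining cases are 2^5 <= 3^4 and 3^5 <=
    4^4. *)
Lemma leq_exp5_exp4 D N : (0 < N)%N -> (2 * D ^ 2 <= N)%N ->
  (D.+2 ^ 5 <= N.+2 ^ 4)%N.
Proof.
move=> N0 DN; have [D2|] := leqP 2 D.
  apply: (@leq_trans ((2 * D ^ 2) ^ 4)%N); last by rewrite leq_exp2r//; lia.
  apply: (@leq_trans ((2 * D) ^ 5)%N); first by rewrite leq_exp2r//; lia.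
  rewrite [(D ^ 2)%N]expnS expn1 mulnA (expnMn (2 * D)%N) expnSr leq_mul2l.
  have D3 : (D <= D ^ 3)%N by rewrite -{1}[D]expn1 leq_pexp2l//; lia.
  by rewrite [(D ^ 4)%N]expnSr leq_mul ?orbT// (leq_trans D2).
case: D DN => [|[|//]] DN _.
  by apply: (@leq_trans (3 ^ 4)%N) => //; rewrite leq_exp2r//; lia.
by apply: (@leq_trans (4 ^ 4)%N) => //; rewrite leq_exp2r//; lia.
Qed.

(** * Logarithmic growth of a positive operator t on X, with s as (2 - t)^-1 *)

Section LogGrowth.
Variables (R : realType) (X : banachLatticeType R).
Variables (t s : {linear X -> X}) (C : R).
Hypothesis t0 : forall x, 0 <=: x -> 0 <=: t x.
Hypothesis s0 : forall x, 0 <=: x -> 0 <=: s x.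
Hypothesis ts : forall x, 2 *: s x = x + t (s x).
Hypothesis sC : forall N x, (0 < N)%N -> `|iter N s x| <= C * `|x|.

(** Partial sums below S^N x suffice, so no convergence is involved. In 2 S^(N+1) x = S^N x + T
    S^(N+1) x, the first term is bounded below by row N and the second by row N + 1 with one term
    fewer. *)
Lemma nbin_sum_le N K x : 0 <=: x ->
  \sum_(n < K) nbin R N n *: iter n t x <=: iter N s x.
Proof.
move=> x0; elim: N K => [|N IHN] K.
  case: K => [|K]; first by rewrite big_ord0.
  rewrite big_ord_recl big1 => [|i _]; last by rewrite nbin0S scale0r.
  by rewrite addr0 /nbin/= bin0 expr0 divr1 scale1r ble_refl.
elim: K => [|K IHK]; first by rewrite big_ord0; exact: positive_iter.
suff : (2 : R) *: \sum_(n < K.+1) nbin R N.+1 n *: iter n t x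
    <=: 2 *: iter N.+1 s x.
  have h : 0 <= 2^-1 :> R by lra.
  by move=> /(bleZ h); rewrite !scalerA mulVf// !scale1r.
rewrite [iter N.+1 s x]iterS ts.
suff -> : (2 : R) *: \sum_(n < K.+1) nbin R N.+1 n *: iter n t x =
   \sum_(n < K.+1) nbin R N n *: iter n t x +
   t (\sum_(n < K) nbin R N.+1 n *: iter n t x).
  by apply: bleD; [exact: IHN|apply: positive_mono].
rewrite !big_ord_recl scalerDr scalerA nbinS0 -addrA; congr (_ + _).
rewrite scaler_sumr linear_sum -big_split/=; apply: eq_bigr => i _.
by rewrite scalerA nbinSS scalerDl linearZ.
Qed.

Lemma nbin_window_le N D x : (D <= N)%N -> 0 <=: x ->
  \sum_(j < D.+1) nbin R N (N - j) *: iter (N - j) t x <=: iter N s x.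
Proof.
move=> DN x0; apply: ble_trans (nbin_sum_le N N.+1 x0).
rewrite [X in _ <=: X](reindex_inj rev_ord_inj)/=.
under [X in _ <=: X]eq_bigr do rewrite subSS.
rewrite -!(big_mkord xpredT (fun j => nbin R N (N - j) *: iter (N - j) t x)).
rewrite (@big_cat_nat _ _ _ D.+1 0 N.+1)//= -bsub_ge0 addrAC subrr add0r.
apply: bsum_ge0 => j _; apply: bscale_ge0; first exact: nbin_ge0.
exact: positive_iter.
Qed.

Lemma iter_norm_step N D (B : R) x : AL_space X \/ AM_space X ->
  (0 < N)%N -> (2 * D ^ 2 <= N)%N -> (N < 2 * D.+1 ^ 2)%N ->
  (forall j y, (j <= D)%N -> 0 <=: y -> `|iter j t y| <= B * `|y|) ->
  0 <=: x -> `|iter N t x| <= 12 * C * B * `|x|.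
Proof.
move=> hX N0 DN ND hB x0; have DleN : (D <= N)%N by nia.
have W := nbin_window R N0 DN ND; set m := \sum_(_ < _) _ in W.
have split_iter (j : 'I_D.+1) : iter N t x = iter (N - j) t (iter j t x).
  by rewrite -iterD subnK// (leq_trans _ DleN)// -ltnS.
(* The factor 12 is the inverse of the lower bound on the window mass m. *)
suff : m * `|iter N t x| <= C * B * `|x|.
  have /ler_wpM2r := W => /(_ _ (normr_ge0 (iter N t x))) h1 h2.
  by have := le_trans h1 h2; lra.
have [x00|xn] := eqVneq `|x| 0.
  have -> : iter N t x = 0.
    by rewrite (normr0_eq0 x00); elim: (N) => //= n ->; rewrite linear0.
  by rewrite x00 normr0 !mulr0.
have xp : 0 < `|x| by rewrite lt_neqAle eq_sym xn/=.
have C0 : 0 <= C.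
  by rewrite -(pmulr_lge0 _ xp); exact: (le_trans _ (sC x N0)).
have B0 : 0 <= B.
  rewrite -(pmulr_lge0 _ xp); have := hB 0%N x (leq0n D) x0.
  exact: le_trans.
case: hX => [AL|AM].
  (* Bound T^N x by B times the norm of T^(N-j) x for each j; additivity of the norm on the cone
     then turns the weighted sum of norms into the norm of the window sum. *)
  apply: (@le_trans _ _ (B * \sum_(j < D.+1)
      `|nbin R N (N - j) *: iter (N - j) t x|)).
    rewrite mulr_suml mulr_sumr; apply: ler_sum => j _.
    rewrite normrZ ger0_norm ?nbin_ge0// mulrCA; apply: ler_wpM2l.
      exact: nbin_ge0.
    have jD : (j <= D)%N by rewrite -ltnS.
    have -> : iter N t x = iter j t (iter (N - j) t x).
      by rewrite -iterD subnKC// (leq_trans jD).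
    by apply: hB => //; exact: positive_iter.
  rewrite mulrAC [leRHS]mulrC; apply: ler_wpM2l => //.
  rewrite -AL_norm_sum// => [|j]; last first.
    by apply: bscale_ge0; [exact: nbin_ge0|exact: positive_iter].
  apply: (le_trans _ (sC x N0)); apply: norm_ble (nbin_window_le DleN x0).
  apply: bsum_ge0 => j _.
  by apply: bscale_ge0; [exact: nbin_ge0|exact: positive_iter].
(* As z dominates T^j x for j <= D, every T^(N-j) z dominates T^N x, so the window sum at z
   dominates m T^N x. *)
pose z := bsups x [seq iter j t x | j <- iota 0 D.+1].
have zub (j : 'I_D.+1) : iter j t x <=: z.
  by apply: bsups_ub; apply/mapP; exists (val j); rewrite // mem_iota/= add0n.
have z0 : 0 <=: z by apply: (ble_trans x0); exact: (zub ord0).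
have zB : `|z| <= B * `|x|.
  apply: AM_norm_bsups => // y; rewrite inE => /orP[/eqP ->|].
    by split => //; exact: (hB 0%N).
  move=> /mapP[j]; rewrite mem_iota/= add0n ltnS => jD ->.
  by split; [exact: positive_iter|exact: hB].
rewrite -mulrA; apply: (le_trans _ (ler_wpM2l C0 zB)).
apply: (le_trans _ (sC z N0)); have m0 : 0 <= m by lra.
rewrite -[m]ger0_norm// -normrZ; apply: norm_ble.
  by apply: bscale_ge0 => //; exact: positive_iter.
apply: ble_trans (nbin_window_le DleN z0).
rewrite scaler_suml; apply: ble_sum => j _; apply: bleZ; first exact: nbin_ge0.
by rewrite (split_iter j); exact: positive_iter_mono.
Qed.

(** Strong induction replaces the explicit iteration: one step costs 12 C <= (5/4)^k, which is
    recovered from (5/4) ln (D + 2) <= ln (N + 2). *)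
Lemma iter_log_growth : AL_space X \/ AM_space X ->
  exists k : nat, exists A : R, [/\ (0 < k)%N, 0 < A &
    forall N x, 0 <=: x -> `|iter N t x| <= A * ln N.+2%:R ^+ k * `|x|].
Proof.
move=> hX.
have l0 n : 0 < ln n.+2%:R :> R by rewrite ln_gt0// ltr1n.
(* 5/4 is the ratio for which (5/4) ln (D + 2) <= ln (N + 2). *)
have [k k0 hk] : exists2 k : nat, (0 < k)%N & 12 * C <= (5 / 4) ^+ k.
  have bernoulli n : n%:R / 4 <= (5 / 4) ^+ n :> R.
    elim: n => [|n IH]; first by rewrite mul0r.
    have : 1 <= (5 / 4 : R) ^+ n by rewrite exprn_ege1//; lra.
    by rewrite exprS -[n.+1%:R]natr1; lra.
  exists (Num.truncn (48 * C)).+1 => //; apply: le_trans (bernoulli _).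
  by have := truncnS_gt (48 * C); lra.
(* This constant makes the bound an equality at N = 0; the shift by 2 keeps the logarithm positive
   there. *)
exists k, (ln 2%:R ^- k); split => //; first by rewrite invr_gt0 exprn_gt0// l0.
set A := _ ^- k; have A0 : 0 < A by rewrite invr_gt0 exprn_gt0// l0.
elim/ltn_ind => N IH x x0; have [->|N0] := posnP N.
  by rewrite mulVf ?mul1r// expf_neq0// gt_eqF// l0.
(* D is the integer part of sqrt (N / 2). *)
have [D DN ND] : exists2 D : nat, (2 * D ^ 2 <= N)%N & (N < 2 * D.+1 ^ 2)%N.
  have ex : exists i : nat, (2 * i ^ 2 <= N)%N by exists 0%N.
  have ub (i : nat) : (2 * i ^ 2 <= N)%N -> (i <= N)%N by nia.
  case: (ex_maxnP ex ub) => D DN Dmax; exists D => //.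
  by rewrite ltnNge; apply/negP => /Dmax; rewrite ltnn.
apply: le_trans
  (@iter_norm_step N D (A * ln D.+2%:R ^+ k) x hX N0 DN ND _ x0) _.
  move=> j y jD y0; apply: (le_trans (IH j _ y y0)); first by nia.
  apply: ler_wpM2r => //; apply: ler_wpM2l; first exact: ltW.
  rewrite lerXn2r ?nnegrE ?(ltW (l0 _))// ler_ln ?posrE//.
  by rewrite ler_nat !ltnS.
apply: ler_wpM2r => //; rewrite mulrCA; apply: ler_wpM2l; first exact: ltW.
apply: (@le_trans _ _ ((5 / 4) ^+ k * ln D.+2%:R ^+ k)).
  by apply: ler_wpM2r => //; rewrite exprn_ge0// ltW// l0.
rewrite -exprMn lerXn2r ?nnegrE ?mulr_ge0 ?(ltW (l0 _))//.
suff : 5%:R * ln D.+2%:R <= 4%:R * ln N.+2%:R :> R by lra.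
rewrite !mulr_natl -!lnXn// ler_ln ?posrE ?exprn_gt0//.
by rewrite -!natrX ler_nat leq_exp5_exp4.
Qed.

End LogGrowth.

(** * From positive vectors to the operator norm on the complexification *)

Section Extension.
Variables (R : realType) (X : banachLatticeType R).

(** Positivity gives |t^N x| <= t^N |x|, which extends the bound to all real x; the factor 2 comes
    from treating real and imaginary parts separately. *)
Lemma opnorm_iter_le (T : {linear complexification X -> complexification X})
    (t : {linear X -> X}) N (B : R) :
  (forall x, T (x, 0) = (t x, 0)) -> (forall x, 0 <=: x -> 0 <=: t x) ->
  0 <= B -> (forall x, 0 <=: x -> `|iter N t x| <= B * `|x|) ->
  opnorm (iter N T) <= 2 * B.
Proof.
move=> Tt t0 B0 hB.
have tB x : `|iter N t x| <= B * `|x|.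
  rewrite -(bnorm_abs x); apply: (le_trans _ (hB _ (babs_ge0 x))).
  apply: bnorm_le; first by apply: positive_iter_mono => //; exact: ble_abs.
  have -> : - iter N t x = iter N t (- x).
    by elim: (N) => //= n <-; rewrite linearN.
  by apply: positive_iter_mono => //; exact: bleN_abs.
have TE x y : iter N T (x, y) = (iter N t x, iter N t y).
  elim: (N) => //= n ->.
  have -> u v : (u, v) =
      ((u, 0) : complexification X) + 'i%C *: ((v, 0) : complexification X).
    by rewrite cscaleE/= !scale0r scaler0 subr0 scale1r;
      congr (_, _); rewrite /= ?addr0 ?add0r.
  rewrite linearD linearZZ !Tt cscaleE/= !scale0r scaler0 subr0 scale1r.
  by congr (_, _); rewrite /= ?addr0 ?add0r.
apply: ge_sup.
  by exists (rnorm (iter N T 0)), 0 => //=; rewrite /rnorm normr0/= ler01.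
move=> _ [[x y] /= z1 <-]; rewrite TE rnormE.
apply: (le_trans (norm_modulus_le _)) => /=.
have := norm1_le_modulus ((x, y) : complexification X).
have := norm2_le_modulus ((x, y) : complexification X).
rewrite rnormE in z1; move=> /= y1 x1.
have -> : 2 * B = B + B by ring.
apply: lerD; apply: (le_trans (tB _)); rewrite ler_piMr//.
  exact: le_trans z1.
exact: le_trans z1.
Qed.

End Extension.

Theorem proposition5p6 (R : realType) (X : banachLatticeType R)
    (T : {linear complexification X -> complexification X})
    (hX : AL_space X \/ AM_space X)
    (hpos : positive_op T)
    (hT : strongly_Kreiss_bounded T) :
  exists C kappa : R, [/\ 0 < C, 0 < kappa &
    forall N : nat, (1 <= N)%N ->
      opnorm (iter N T) <= C * (ln N.+1%:R) `^ kappa].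
Proof.
have lt12 : 1 < 2 :> R by lra.
have [S hS] := resolvent_exists hT lt12.
have posS := resolvent_pos hpos hT lt12 hS.
have [t Tt t0] := positive_op_real hpos.
have [s Ss s0] := positive_op_real posS.
have [bS _ SK] := hS; have [_ _ [C C0 hC]] := hT.
have ts x : 2 *: s x = x + t (s x).
  have := SK (x, 0); rewrite Ss Tt scale_realC => -[/eqP + _].
  by rewrite subr_eq => /eqP.
(* At 2 the denominator (2 - 1)^N is 1, so the Kreiss condition bounds all powers uniformly. *)
have sC N x : (0 < N)%N -> `|iter N s x| <= C * `|x|.
  move=> N0; have := rnorm_le_opnorm N (x, 0) bS.
  have -> : iter N S (x, 0) = (iter N s x, 0) by elim: (N) => //= n ->.
  rewrite !rnorm_real => /le_trans; apply; apply: ler_wpM2r => //.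
  have := hC 2%:C%C S N; rewrite rnorm_realC ger0_norm; last by lra.
  move=> /(_ lt12 hS N0) /le_trans; apply.
  by rewrite (_ : 2 - 1 = 1 :> R) ?expr1n ?divr1//; ring.
have [k [A [k0 A0 hA]]] := iter_log_growth t0 s0 ts sC hX.
(* The factor 2^k comes from ln (N + 2) <= 2 ln (N + 1), valid for N >= 1 as N + 2 <= (N + 1)^2; the
   outer 2 comes from complexification. *)
exists (2 * (A * 2 ^+ k)), k%:R; split.
- by rewrite !mulr_gt0// exprn_gt0.
- by rewrite ltr0n.
move=> N N1; have l0 n : 0 < ln n.+2%:R :> R by rewrite ln_gt0// ltr1n.
case: N N1 => // N _; rewrite powR_mulrn ?(ltW (l0 _))//.
apply: (@le_trans _ _ (2 * (A * ln N.+3%:R ^+ k))).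
  apply: opnorm_iter_le Tt t0 _ (hA _).
  by rewrite mulr_ge0 ?exprn_ge0 ?ltW.
rewrite -!mulrA -exprMn; apply: ler_wpM2l => //.
apply: ler_wpM2l; first exact: ltW.
rewrite lerXn2r ?nnegrE ?mulr_ge0 ?(ltW (l0 _))//.
rewrite mulr_natl -lnXn// ler_ln ?posrE ?exprn_gt0// -natrX ler_nat; nia.
Qed.
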